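(* For each $c>0$ let $u^c\in\mathbb R^{N\times d}$ be the solution of the quasi-variational inequality $$\min\Big(F_i(u^c),\,u^{c,i}-\max_{j\ne i}(u^{c,j}-c)\Big)=0,\qquad i\in\mathcal I.$$ Then, as $c\to0$, $(u^c)_{c>0}$ converges monotonically from below to the solution $\mathbf u$ of the following problem: find $\bar u\in\mathbb R^N$ such that $\mathbf u=(\bar u,\dots,\bar u)\in\mathbb R^{N\times d}$ satisfies $$\min_{i\in\mathcal I}F_i(\mathbf u)=0 .$$
   Context: Let $N\ge1$ and $d\ge 2$ be integers, $\mathcal I=\{1,\dots,d\}$, $\mathcal N=\{1,\dots,N\}$. An element $u\in\mathbb R^{N\times d}$ is written $u=(u^1,\dots,u^d)$ with $u^i\in\mathbb R^N$ and entries $u^i_l$. Inequalities, minima and maxima of vectors/matrices are understood elementwise, and adding or subtracting a scalar acts on every entry. ''Monotonically from below as $c\to 0$'' means $u^{c_2}\ge u^{c_1}$ whenever $c_1>c_2>0$ (so $u^c$ increases to its limit as $c$ decreases to $0$). $F=(F_i)_{i\in\mathcal I}:\mathbb R^{N\times d}\to\mathbb R^{N\times d}$ (with $F_i(u)\in\mathbb R^N$) is a continuous function satisfying the monotonicity condition: there is a constant $\gamma>0$ such that for any $u,v\in\mathbb R^{N\times d}$, $i\in\mathcal I$, $l\in\mathcal N$ with $u^i_l-v^i_l=\max_{j\in\mathcal I,k\in\mathcal N}(u^j_k-v^j_k)\ge 0$, one has $F_i(u)_l-F_i(v)_l\ge\gamma(u^i_l-v^i_l)$. The quasi-variational inequality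 has a unique solution for each $c>0$, and the limiting problem $\min_{i\in\mathcal I}F_i(\mathbf u)=0$ has at most one solution of the form $\mathbf u=(\bar u,\dots,\bar u)$. *)

(* Defs.v *)
From HB Require Import structures.
From mathcomp Require Import all_boot all_order all_algebra.
From mathcomp Require Import all_classical all_reals all_analysis.

Set Implicit Arguments.
Unset Strict Implicit.
Unset Printing Implicit Defensive.

Import Order.TTheory GRing.Theory Num.Theory numFieldNormedType.Exports.

Local Open Scope classical_set_scope.
Local Open Scope ring_scope.

(* The entry u^i_l is [u l i]: row l : 'I_N, column i : 'I_d.
   Finite maxima and minima of reals are taken in \bar R, with neutral elements
   -oo and +oo; they are finite reals whenever the index set is nonempty. *)

Definition monotone_system (R : realType) (N d : nat)
    (F : 'M[R]_(N, d) -> 'M[R]_(N, d)) : Prop :=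
  exists2 gamma : R, 0 < gamma &
    forall (u v : 'M[R]_(N, d)) (i : 'I_d) (l : 'I_N),
      (u l i - v l i)%:E =
        (\big[maxe/-oo]_(j < d) \big[maxe/-oo]_(k < N) (u k j - v k j)%:E)%E ->
      0 <= u l i - v l i ->
      gamma * (u l i - v l i) <= F u l i - F v l i.

Definition qvi_solution (R : realType) (N d : nat)
    (F : 'M[R]_(N, d) -> 'M[R]_(N, d)) (c : R) (u : 'M[R]_(N, d)) : Prop :=
  forall (i : 'I_d) (l : 'I_N),
    (mine (F u l i)%:E
          ((u l i)%:E - \big[maxe/-oo]_(j < d | j != i) (u l j - c)%:E) = 0)%E.

Definition diag_embed (R : realType) (N d : nat) (w : 'cV[R]_N) :
    'M[R]_(N, d) :=
  \matrix_(l < N, i < d) w l ord0.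

Definition limit_solution (R : realType) (N d : nat)
    (F : 'M[R]_(N, d) -> 'M[R]_(N, d)) (w : 'cV[R]_N) : Prop :=
  forall l : 'I_N,
    (\big[mine/+oo]_(i < d) (F (diag_embed d w) l i)%:E = 0)%E.

(* Main.v *)
(* Monotonicity of [F] gives a comparison principle: look at a maximum point of
   [u - v] with positive value.  If the obstacle is active for [u = u^{c1}]
   there, then [u^i = u^j - c1], while [v = u^{c2}] satisfies [v^i >= v^j - c2];
   since [c2 < c1] the difference at [j] is strictly larger, a contradiction.
   Comparison with a large constant bounds [u^c], so [u^c] converges as [c -> 0];
   the obstacle constraint forces all components of the limit to coincide.
   A component maximal at [l] can never touch the obstacle, so for every [c]
   some [F_i(u^c)_l] vanishes, and this passes to the limit. *)

Require Import Defs.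
From HB Require Import structures.
From mathcomp Require Import all_boot all_order all_algebra.
From mathcomp Require Import all_classical all_reals all_analysis.
From mathcomp Require Import lra.

Set Implicit Arguments.
Unset Strict Implicit.
Unset Printing Implicit Defensive.

Import Order.TTheory GRing.Theory Num.Theory numFieldNormedType.Exports.

Local Open Scope classical_set_scope.
Local Open Scope ring_scope.

(** The index [i0] makes the range nonempty, so the minimum is attained instead of being [+oo]. *)
Lemma bigmine_eq0P (R : realType) (d : nat) (i0 : 'I_d) (f : 'I_d -> R) :
  (\big[mine/+oo]_(i < d) (f i)%:E = 0)%E <->
  (forall i, 0 <= f i) /\ exists i, f i = 0.
Proof.
split=> [f0|[f_ge0 [i fi0]]].
  split=> [i|].
    by rewrite -lee_fin -[leLHS]/(0 : \bar R)%E -f0; exact: bigmin_le_cond.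
  move: f0; rewrite (bigmin_eq_arg _ i0) => // [|i _]; last exact: leey.
  by case=> fm0; exists [arg min_(i < i0) (f i)%:E]%O.
apply/eqP; rewrite eq_le; apply/andP; split.
  by apply: (bigmin_inf i) => //; rewrite fi0.
by apply: le_bigmin => [|j _]; rewrite ?leey ?lee_fin.
Qed.

Lemma qvi_solutionP (R : realType) (N d : nat) (F : 'M[R]_(N, d) -> 'M[R]_(N, d))
    (c : R) (u : 'M[R]_(N, d)) (l : 'I_N) (i : 'I_d) :
  (2 <= d)%N -> qvi_solution F c u ->
  [/\ 0 <= F u l i, forall j, j != i -> u l j - c <= u l i
    & F u l i = 0 \/ exists2 j, j != i & u l i = u l j - c].
Proof.
move=> hd /(_ i l).
(* Since [2 <= d], the obstacle is a maximum over a nonempty set of indices. It is therefore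
   attained and finite, and the equation can be read in the reals. *)
have [j0 j0i] : exists j, j != i.
  have [i0|i0] := eqVneq (val i) 0%N.
    by exists (Ordinal hd); rewrite -val_eqE /= i0.
  by exists (Ordinal (ltnW hd)); rewrite -val_eqE /= eq_sym.
have -> : (\big[maxe/-oo]_(j < d | j != i) (u l j - c)%:E =
    (u l [arg max_(j > j0 | j != i) (u l j - c)%:E]%O - c)%:E)%E.
  by rewrite (bigmax_eq_arg _ j0) // => j _; rewrite leNye.
case: arg_maxP => // j ji j_max.
rewrite -EFinB -EFin_min => -[min0].
have Fge0 : 0 <= F u l i by rewrite -min0 ge_min lexx.
have uge : 0 <= u l i - (u l j - c) by rewrite -min0 ge_min lexx orbT.
split=> // [k ki|].
  by apply: le_trans (_ : u l j - c <= _); [rewrite -lee_fin; exact: j_max | rewrite -subr_ge0].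
move: min0; rewrite minEle; case: ifP => _ h; [by left|right].
by exists j => //; apply/eqP; rewrite -subr_eq0 h.
Qed.

(* At a point where [u - v] attains a positive maximum, monotonicity forces
   [F u > F v >= 0], which the last hypothesis excludes. *)
Lemma comparison (R : realType) (N d : nat) (F : 'M[R]_(N, d) -> 'M[R]_(N, d))
    (u v : 'M[R]_(N, d)) :
  monotone_system F -> (forall l i, 0 <= F v l i) ->
  (forall l i, 0 < u l i - v l i ->
     exists2 j, u l i - v l i <= u l j - v l j &
       F u l j <= 0 \/ u l i - v l i < u l j - v l j) ->
  forall l i, u l i <= v l i.
Proof.
move=> [g g0 mono] Fv Fu l0 i0; rewrite leNgt; apply/negP => uv0.
pose D (p : 'I_N * 'I_d) := u p.1 p.2 - v p.1 p.2.
case: (@arg_maxP _ _ _ (l0, i0) xpredT D isT) => -[l i] _ D_max.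
have D0 : 0 < u l i - v l i.
  apply: lt_le_trans (D_max (l0, i0) isT); by rewrite subr_gt0.
(* A strictly larger difference at [j] contradicts maximality. Otherwise [(l, j)] is again a maximum
   point, and monotonicity is applied there instead of at [(l, i)]. *)
have [j Dj [Fj|]] := Fu l i D0; last by move=> /lt_le_trans /(_ (D_max (l, j) isT)); rewrite ltxx.
have Dj0 := lt_le_trans D0 Dj.
have : g * (u l j - v l j) <= F u l j - F v l j.
  apply: mono (ltW Dj0); apply/eqP; rewrite eq_le; apply/andP; split.
    by apply: (bigmax_sup j) => //; apply: (bigmax_sup l).
  apply: bigmax_le => [|k _]; first exact: leNye.
  apply: bigmax_le => [|m _]; first exact: leNye.
  rewrite lee_fin; exact: le_trans (D_max (m, k) isT) Dj.
have := mulr_gt0 g0 Dj0; have := Fv l j; lra.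
Qed.

Lemma qvi_solution_monotone (R : realType) (N d : nat)
    (F : 'M[R]_(N, d) -> 'M[R]_(N, d)) (c1 c2 : R) (u v : 'M[R]_(N, d)) :
  (2 <= d)%N -> monotone_system F -> c2 < c1 ->
  qvi_solution F c1 u -> qvi_solution F c2 v ->
  forall l i, u l i <= v l i.
Proof.
move=> hd mono c21 uS vS; apply: comparison mono _ _ => [l i|l i _].
  by have [] := qvi_solutionP l i hd vS.
have [_ _ [Fu0|[j ji uj]]] := qvi_solutionP l i hd uS.
  by exists i => //; left; rewrite Fu0.
have [_ /(_ j ji) vj _] := qvi_solutionP l i hd vS.
exists j; [|right]; lra.
Qed.

(** Every entry is a maximum point of a constant matrix minus 0, so monotonicity gives
    [F (const_mx K) >= F 0 + g * K] entrywise for [K >= 0]. Taking [g * K] to be the sum of all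
    [|F 0 l i|] absorbs the negative entries. *)
Lemma monotone_system_const_ge0 (R : realType) (N d : nat)
    (F : 'M[R]_(N, d) -> 'M[R]_(N, d)) : monotone_system F ->
  exists K : R, forall l i, 0 <= F (const_mx K) l i.
Proof.
move=> [g g0 mono].
pose S := \sum_l \sum_i `|F 0 l i|.
have S0 : 0 <= S by apply: sumr_ge0 => l _; apply: sumr_ge0.
have K0 : 0 <= S / g by rewrite divr_ge0 // ltW.
exists (S / g) => l i.
have FS : `|F 0 l i| <= S.
  rewrite /S (bigD1 l) //= (bigD1 i) //= -addrA lerDl addr_ge0 //.
    by apply: sumr_ge0.
  by apply: sumr_ge0 => k _; apply: sumr_ge0.
have : g * (S / g) <= F (const_mx (S / g)) l i - F 0 l i.
  have dE k j : (const_mx (S / g) : 'M[R]_(N, d)) k j -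
      (0 : 'M[R]_(N, d)) k j = S / g by rewrite !mxE subr0.
  rewrite -{1}(dE l i); apply: mono; rewrite !dE //.
  apply/eqP; rewrite eq_le; apply/andP; split.
    by apply: (bigmax_sup i) => //; apply: (bigmax_sup l); rewrite ?dE.
  apply: bigmax_le => [|k _]; first exact: leNye.
  by apply: bigmax_le => [|m _]; rewrite ?leNye ?dE.
rewrite mulrC divfK ?gt_eqF //; have := ler_norm (- F 0 l i); rewrite normrN; lra.
Qed.

(** The constant matrix acts as a supersolution: its columns agree, so where the obstacle is active
    the difference at [j] exceeds that at [i] by [c > 0]. *)
Lemma qvi_solution_bound (R : realType) (N d : nat)
    (F : 'M[R]_(N, d) -> 'M[R]_(N, d)) (K c : R) (u : 'M[R]_(N, d)) :
  (2 <= d)%N -> monotone_system F -> (forall l i, 0 <= F (const_mx K) l i) ->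
  0 < c -> qvi_solution F c u -> forall l i, u l i <= K.
Proof.
move=> hd mono FK c0 uS l i.
suff /(_ l i) : forall l i, u l i <= (const_mx K : 'M[R]_(N, d)) l i by rewrite mxE.
apply: comparison mono FK _ => {}l {}i _.
have [_ _ [Fu0|[j ji uj]]] := qvi_solutionP l i hd uS.
  by exists i => //; left; rewrite Fu0.
exists j; [|right]; rewrite !mxE; lra.
Qed.

(** Applied in both directions, this gives uniqueness. The difference of two diagonal matrices is
    the same in all columns, so comparison may move to a column where [F] vanishes. *)
Lemma limit_solution_le (R : realType) (N d : nat)
    (F : 'M[R]_(N, d) -> 'M[R]_(N, d)) (w w' : 'cV[R]_N) :
  (0 < d)%N -> monotone_system F -> limit_solution F w -> limit_solution F w' ->
  forall l, w l ord0 <= w' l ord0.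
Proof.
move=> d0 mono wS wS' l; pose i0 := Ordinal d0.
suff /(_ l i0) : forall l i, diag_embed d w l i <= diag_embed d w' l i by rewrite !mxE.
apply: comparison mono _ _ => {}l i.
  by have /(bigmine_eq0P i0)[] := wS' l.
have /(bigmine_eq0P i0)[_ [j Fj]] := wS l.
by exists j; [rewrite !mxE | left; rewrite Fj].
Qed.

Lemma cvg_mx_coord (R : realType) (m n : nat) (T : Type) (G : set_system T)
    (FG : Filter G) (f : T -> 'M[R]_(m, n)) (A : 'M[R]_(m, n)) :
  (forall i j, f x i j @[x --> G] --> A i j) -> f x @[x --> G] --> A.
Proof.
move=> fA; apply/cvg_ballP => e e0.
have : \forall x \near G, forall p : 'I_m * 'I_n, ball (A p.1 p.2) e (f x p.1 p.2).
  by apply: filter_forall => p; have /cvg_ballP := fA p.1 p.2; apply.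
by apply: filterS => x fx; split=> // i j; exact: (fx (i, j)).
Qed.

Theorem proposition4p1 (R : realType) (N d : nat)
    (hN : (1 <= N)%N) (hd : (2 <= d)%N)
    (F : 'M[R]_(N, d) -> 'M[R]_(N, d))
    (F_cont : continuous F) (F_mono : monotone_system F)
    (u : R -> 'M[R]_(N, d))
    (u_sol : forall c : R, 0 < c -> qvi_solution F c (u c)) :
  (forall c1 c2 : R, 0 < c2 -> c2 < c1 ->
     forall (l : 'I_N) (i : 'I_d), u c1 l i <= u c2 l i) /\
  exists ubar : 'cV[R]_N,
    [/\ limit_solution F ubar,
        forall w : 'cV[R]_N, limit_solution F w -> w = ubar
      & u c @[c --> 0^'+] --> diag_embed d ubar].
Proof.
have u_mono (c1 c2 : R) : 0 < c2 -> c2 < c1 -> forall l i, u c1 l i <= u c2 l i.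
  move=> c20 c21; apply: (qvi_solution_monotone hd F_mono c21); apply: u_sol => //.
  exact: lt_trans c21.
split=> //.
have [K FK] := monotone_system_const_ge0 F_mono.
have [U uU] : exists U : 'M[R]_(N, d), u c @[c --> 0^'+] --> U.
  (* Each entry is nonincreasing in [c] and bounded by [K], so its right limit at 0 is the supremum
     over all [c > 0]. *)
  exists (\matrix_(l, i) sup ((fun c => u c l i) @` `]0, +oo[%classic)).
  apply: cvg_mx_coord => l i; rewrite mxE.
  apply: nonincreasing_at_right_cvgr => //.
    move=> c1 c2; rewrite !in_itv /= !andbT => c10 c20.
    by rewrite le_eqVlt => /predU1P[->//|c12]; exact: u_mono.
  exists K => _ [c /= + <-]; rewrite in_itv /= andbT => c0.
  exact: (qvi_solution_bound hd F_mono FK c0 (u_sol _ c0)).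
have c_gt0 : \forall c \near (0 : R)^'+, 0 < c by exact: nbhs_right_gt.
have coordU l i : u c l i @[c --> 0^'+] --> U l i.
  exact: (continuous_cvg _ (@coord_continuous R N d l i U) uU).
have FuU : F (u c) @[c --> 0^'+] --> F U by exact: (continuous_cvg _ (F_cont U) uU).
have coordFU l i : F (u c) l i @[c --> 0^'+] --> F U l i.
  exact: (continuous_cvg _ (@coord_continuous R N d l i (F U)) FuU).
pose i0 : 'I_d := Ordinal (ltnW hd).
(* Let [c] tend to 0 in the obstacle constraint; exchanging [i] and [j] then makes the columns of
   [U] equal. *)
have U_le l i j : U l j <= U l i.
  have [->//|ji] := eqVneq j i.
  have cvgU : u c l j - c @[c --> 0^'+] --> U l j - 0.
    by apply: cvgB => //; exact: cvg_at_right_filter.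
  rewrite -[U l j]subr0; apply: ler_cvg_to cvgU (coordU l i) _.
  apply: filterS c_gt0 => c c0.
  by have [_ /(_ j ji)] := qvi_solutionP l i hd (u_sol c c0).
have UE : diag_embed d (col i0 U) = U.
  by apply/matrixP => l i; rewrite !mxE; apply/eqP; rewrite eq_le !U_le.
have U_sol : limit_solution F (col i0 U).
  move=> l; apply/(bigmine_eq0P i0); rewrite UE.
  have FU_ge0 i : 0 <= F U l i.
    apply: ler_cvg_to (cvg_cst 0) (coordFU l i) _.
    apply: filterS c_gt0 => c c0.
    by have [] := qvi_solutionP l i hd (u_sol c c0).
  (* If no [F U l i] vanished, all would be positive. As there are finitely many columns, one small
     [c] would make every [F (u c) l i] positive, which fails at the largest entry of row [l]. *)
  split=> //; apply: contrapT => FU_neq0.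
  have FU_gt0 : \forall c \near (0 : R)^'+, forall i, 0 < F (u c) l i.
    apply: filter_forall => i; apply: cvgr_gt (coordFU l i) _ _.
    rewrite lt_neqAle FU_ge0 andbT eq_sym.
    by apply/eqP => FU0; apply: FU_neq0; exists i.
  have [c [c0 Fc]] := filter_ex (filterI c_gt0 FU_gt0).
  case: (@arg_maxP _ _ _ i0 xpredT (u c l) isT) => i _ i_max.
  have [_ _ [Fi0|[j _ uj]]] := qvi_solutionP l i hd (u_sol c c0).
    by have := Fc i; rewrite Fi0 ltxx.
  by have /= := i_max j isT; lra.
exists (col i0 U); split=> [//|w w_sol|]; last by rewrite UE.
apply/matrixP => l k; rewrite ord1; apply/eqP; rewrite eq_le.
by rewrite !(limit_solution_le (ltnW hd) F_mono).
Qed.
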